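(* Let $1\le p,q<\infty$ and let $\mathcal{Y}$ be a set of $\nu$-measurable functions on $X$. Suppose that for every $m\in\mathbf{N}$ there are finitely many sets $E_i=E_i(m)\subset X$ and $E_i'=E_i'(m)\subset X$, $i=1,\dots,K_m$, such that: (C1) the $E_i$ are $\nu$-measurable, $\nu\bigl(E\setminus\bigcup_{i=1}^{K_m}E_i\bigr)=0$, and $0<\nu(E_i)<\infty$ for all $i$; the $E_i'$ are $\mu$-measurable; (C2) there are mappings $a_{E_i}:\mathcal{Y}\to\mathbf{R}$, $i=1,\dots,K_m$, and $G_m:\mathcal{Y}\to L^p(X,\mu)$ with $G_m(u)\ge0$ $\mu$-a.e., and a constant $C_m$ (independent of $u$ and $i$) such that for all $u\in\mathcal{Y}$ and $i=1,\dots,K_m$, $$\biggl(\int_{E_i}|u-a_{E_i}(u)|^q\,d\nu\biggr)^{1/q}\le C_m\biggl(\int_{E_i'}G_m(u)^p\,d\mu\biggr)^{1/p}.$$ Let $N_m:=\operatorname*{ess\,sup}_{x\in X}\sum_{i=1}^{K_m}\chi_{E_i'}(x)$, with the essential supremum taken with respect to $\mu$. Let $\{u_n\}_{n=1}^\infty$ be a sequence in $\mathcal{Y}$ such that the sequence $\{a_{E_i}(u_n)\}_{n=1}^\infty$ is bounded for every fixed $m$ and $i=1,\dots,K_m$. Assume that one of the following conditions holds: (i) $1\le p\le q<\infty$ and $\displaystyle\lim_{m\to\infty}C_mN_m^{1/p}\sup_n\|G_m(u_n)\|_{L^p(X,\mu)}=0$; (ii) $1\le q<p<\infty$ and $\displaystyle\lim_{m\to\infty}C_mN_m^{1/p}K_m^{1/q-1/p}\sup_n\|G_m(u_n)\|_{L^p(X,\mu)}=0$.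 Then $\{u_n\}_{n=1}^\infty$ has a subsequence converging in $L^q(E,\nu)$.
   Context: $X$ is a metric space equipped with positive complete Borel measures $\mu$ and $\nu$, and $E\subset X$ is $\nu$-measurable with $\nu(E)>0$. $\chi_A$ is the characteristic function of $A$. The sets $E_i,E_i'$ and the mappings $a_{E_i}$, $G_m$ may depend on $m$; $G_m$ need not be linear or local. *)

(* Defs.v *)
From HB Require Import structures.
From mathcomp Require Import all_boot all_order all_algebra.
From mathcomp Require Import all_classical all_reals all_analysis.
From mathcomp Require Import measurable_realfun ess_sup_inf.
Import Order.TTheory GRing.Theory Num.Theory.
Import numFieldNormedType.Exports.

Set Implicit Arguments.
Unset Strict Implicit.
Unset Printing Implicit Defensive.

Local Open Scope classical_set_scope.
Local Open Scope ring_scope.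
Local Open Scope ereal_scope.

(* Nonempty metric spaces: measurableType requires a base point. *)
#[short(type="pointedMetricType")]
HB.structure Definition PointedMetric (K : numDomainType) :=
  {M of Metric K M & Pointed M}.

(* The sigma-algebra of measurable sets of mu is <<s S>>; it may be larger than
   the Borel sigma-algebra, and every sigma-algebra S equals <<s S>>.  Keeping S
   as a parameter lets two measures on the same metric space have different
   sigma-algebras of measurable sets. *)
Definition complete_borel (R : realType) (X : pointedMetricType R) (S : set (set X))
    (mu : {measure set (g_sigma_algebraType S) -> \bar R}) : Prop :=
  (forall A : set X, open A -> <<s S >> A) /\ measure_is_complete mu.

(* If mu is the zero measure, ess_sup mu takes the value -oo instead of 0;
   this is harmless here because -oo `^ r = 0 for r != 0. *)
Definition max_overlap (d : measure_display) (X : measurableType d)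
    (R : realType) (mu : {measure set X -> \bar R}) (k : nat)
    (F : 'I_k -> set X) : \bar R :=
  ess_sup mu (fun x => (\sum_(i < k) \1_(F i) x)%:E).

(* Functions are extended-real valued; an element of the Lp space is finite
   almost everywhere, so the limit is taken real valued. *)
Definition converges_in_Lp (d : measure_display) (X : measurableType d)
    (R : realType) (mu : {measure set X -> \bar R}) (p : R)
    (f : nat -> X -> \bar R) : Prop :=
  (forall n, measurable_fun setT (f n) /\ 'N[mu]_p%:E[f n] < +oo) /\
  exists2 g : X -> R, g \in Lfun mu p%:E &
    'N[mu]_p%:E[f n \- (EFin \o g)] @[n --> \oo] --> 0.

(* Main.v *)
(* For each m the hypotheses approximate all the u_n uniformly, in L^q(E, nu), by
   functions constant on the pieces E_i: summing the Poincare inequalities over i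
   costs N_m (bounded overlap) and either the superadditivity of t^(q/p) for
   p <= q or Hoelder's inequality for q < p.  The constants a_(E_i)(u_n) are
   bounded in n, hence converge along a fixed free ultrafilter on the integers,
   and so the u_n are Cauchy in L^q(E, nu) along this ultrafilter.  A subsequence
   with geometrically decreasing distances then converges. *)
Require Import Defs.
From HB Require Import structures.
From mathcomp Require Import all_boot all_order all_algebra.
From mathcomp Require Import all_classical all_reals all_analysis.
From mathcomp Require Import measurable_realfun ess_sup_inf.
From mathcomp Require Import ring lra.
Import Order.TTheory GRing.Theory Num.Theory.
Import numFieldNormedType.Exports.

Local Open Scope classical_set_scope.
Local Open Scope ring_scope.

(** * Finite sums of powers of nonnegative reals *)

(** With [S] the sum of the [b i], write [S]^ r[as the sum of]b i * S [^ (r - 1)] and use [b i <= S]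
    in each term. *)
Lemma sum_powR_ge1 {R : realType} {I : finType} (b : I -> R) (r : R) :
  (1 <= r) -> (forall i, 0 <= b i) ->
  (\sum_i b i `^ r <= (\sum_i b i) `^ r).
Proof.
move=> r1 b0; have r0 : (0 < r) by rewrite (lt_le_trans _ r1).
rewrite -mulr_powRB1 ?sumr_ge0// mulr_suml ler_sum// => i _.
rewrite -mulr_powRB1// ler_wpM2l// ge0_ler_powR ?subr_ge0 ?nnegrE ?sumr_ge0//.
by rewrite (bigD1 i)//= lerDl sumr_ge0.
Qed.

(** Young's inequality with conjugate exponents [r^-1] and [(1 - r)^-1]. For [a > 0], dividing by
    [a]^ (1 - r)[gives the tangent line at]a[above the concave function]t [^ r]. *)
Lemma powR_tangent {R : realType} (x a r : R) : (0 < r < 1) ->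
  (0 <= x) -> (0 <= a) ->
  (x `^ r * a `^ (1 - r) <= r * x + (1 - r) * a).
Proof.
move=> /andP[r0 r1] x0 a0.
have r10 : (0 < 1 - r) by rewrite subr_gt0.
have := @conjugate_powR R (x `^ r) (a `^ (1 - r)) r^-1 (1 - r)^-1.
rewrite !invrK -!powRrM !mulfV ?gt_eqF// !powRr1// ![(_ * r)]mulrC.
rewrite ![(_ * (1 - r))]mulrC; apply; rewrite ?powR_ge0 ?invr_gt0//.
by rewrite subrKC.
Qed.

Lemma sum_powR_lt1 {R : realType} {I : finType} (b : I -> R) (r : R) :
  (0 < r < 1) -> (forall i, 0 <= b i) ->
  (\sum_i b i `^ r <= #|I|%:R `^ (1 - r) * (\sum_i b i) `^ r).
Proof.
move=> /[dup] r01 /andP[r0 r1] b0; set S := (\sum_i b i).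
have S0 : (0 <= S) by exact: sumr_ge0.
have [S_eq0|SN0] := eqVneq S 0%R.
  rewrite big1 ?mulr_ge0 ?powR_ge0// => i _.
  have -> : b i = 0%R by apply/(psumr_eq0P (fun i _ => b0 i) S_eq0).
  by rewrite powR0 ?gt_eqF.
have Sgt0 : (0 < S) by rewrite lt_neqAle eq_sym SN0.
have K0 : (0 < #|I|%:R :> R).
  rewrite ltr0n lt0n; apply: contra SN0 => /eqP/card0_eq I0.
  by apply/eqP/big1 => i _; have := I0 i; rewrite inE.
pose A := (S / #|I|%:R).
have A0 : (0 < A) by exact: divr_gt0.
have A1r : (0 < A `^ (1 - r)) by exact: powR_gt0.
(* Dividing by [A]^ (1 - r)[gives the claim, since]S / A [^ (1 - r)] is [#|I|]^ (1 - r) * S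
   [^ r]. *)
suff : ((\sum_i b i `^ r) * A `^ (1 - r) <= S).
  rewrite -ler_pdivlMr// => /le_trans; apply.
  have -> : A `^ (1 - r) = S `^ (1 - r) / #|I|%:R `^ (1 - r).
    rewrite /A powRM ?invr_ge0 ?ler0n// -[in X in _ * X = _]powR_inv1 ?ler0n//.
    by rewrite -powRrM mulN1r powRN.
  rewrite -{1}(powRr1 S0) -{1}(subrKC r 1) powRD ?SN0 ?implybT//.
  rewrite invf_div mulrA mulrAC mulfK ?gt_eqF ?powR_gt0//.
  by rewrite mulrC.
rewrite mulr_suml (@le_trans _ _ (\sum_i (r * b i + (1 - r) * A)))//.
  by apply: ler_sum => i _; apply: powR_tangent => //; exact: ltW.
rewrite big_split/= -mulr_sumr -/S sumr_const -mulr_natr -mulrA.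
by rewrite divfK ?gt_eqF// -mulrDl subrKC mul1r.
Qed.

(* The constant comparing the [q]-sum of [k] numbers [b i `^ p^-1] with the
   [p^-1]-th power of their sum: [1] if [p <= q] and Hoelder's constant otherwise. *)
Definition hoelder_const {R : realType} (p q : R) (k : nat) : R :=
  if p <= q then 1 else k%:R `^ (q^-1 - p^-1).

(** The two preceding power-sum bounds with exponent [r = q / p]: the cases [p <= q] and [q < p] are
    [r >= 1] and [r < 1], and [k]^ (1 - r)[is the]q[-th power of]k [^ (q^-1 - p^-1)]. *)
Lemma sum_powR_hoelder {R : realType} (p q c : R) (k : nat) (b : 'I_k -> R) :
  0 < p -> 0 < q -> 0 <= c -> (forall i, 0 <= b i) ->
  \sum_i (c * b i `^ p^-1) `^ q <=
  (c * hoelder_const p q k * (\sum_i b i) `^ p^-1) `^ q.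
Proof.
move=> p0 q0 c0 b0; have S0 : 0 <= \sum_i b i by exact: sumr_ge0.
have kc0 : 0 <= hoelder_const p q k.
  by rewrite /hoelder_const; case: ifP => // _; exact: powR_ge0.
under eq_bigr => i _ do rewrite powRM ?powR_ge0// -powRrM.
rewrite -mulr_sumr -mulrA powRM ?mulr_ge0 ?powR_ge0//.
rewrite ler_wpM2l ?powR_ge0// powRM ?powR_ge0// -powRrM.
rewrite /hoelder_const; have [pq|pq] := leP p q.
  rewrite powR1 mul1r; apply: sum_powR_ge1 => //.
  by rewrite mulrC ler_pdivlMr// mul1r.
rewrite -powRrM mulrBl mulVf ?gt_eqF//.
rewrite -[in X in X%:R `^ _](card_ord k); apply: sum_powR_lt1 => //.
by rewrite mulrC divr_gt0//= ltr_pdivrMr// mul1r.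
Qed.

Local Open Scope ereal_scope.

(** * Integrals of [q]-th powers and the restricted measure *)

(** The sum is at most twice the larger term. If [x] or [y] is infinite, the right-hand side is
    [+oo]. *)
Lemma poweR_normD_le {R : realType} (x y : \bar R) (q : R) : (0 < q)%R ->
  `|x + y| `^ q <= (2 `^ q)%:E * (`|x| `^ q + `|y| `^ q).
Proof.
move=> q0.
have ley t : t <= (2 `^ q)%:E * (+oo : \bar R).
  by rewrite gt0_muley ?leey// lte_fin powR_gt0.
case: x y => [x| |] [y| |]; rewrite ?poweRyr ?gt_eqF// ?addye ?addey//=.
rewrite lee_fin.
have [xy|/ltW xy] := leP `|x|%R `|y|%R.
- apply: (@le_trans _ _ ((2 * `|y|) `^ q)%R).
    rewrite ge0_ler_powR ?nnegrE ?(ltW q0) ?mulr_ge0// mulrDl mul1r.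
    by rewrite (le_trans (ler_normD _ _))// lerD2r.
  by rewrite powRM// ler_wpM2l ?powR_ge0// lerDr powR_ge0.
- apply: (@le_trans _ _ ((2 * `|x|) `^ q)%R).
    rewrite ge0_ler_powR ?nnegrE ?(ltW q0) ?mulr_ge0// mulrDl mul1r.
    by rewrite (le_trans (ler_normD _ _))// lerD2l.
  by rewrite powRM// ler_wpM2l ?powR_ge0// lerDl powR_ge0.
Qed.

Lemma measurable_powR_abse {d} {T : measurableType d} {R : realType} (D : set T)
    (f : T -> \bar R) (q : R) :
  measurable_fun D f -> measurable_fun D (fun x => `|f x| `^ q).
Proof.
move=> mf; apply: (measurableT_comp (measurable_poweR q)).
exact: measurableT_comp.
Qed.

(** Plays the part of Minkowski's inequality, so that the estimates can stay with integrals of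
    [q]-th powers and take no roots. *)
Lemma integral_powR_normD_le {d} {T : measurableType d} {R : realType}
    (mu : {measure set T -> \bar R}) (D : set T) (f g : T -> \bar R) (q : R) :
  (0 < q)%R -> measurable D -> measurable_fun D f -> measurable_fun D g ->
  \int[mu]_(x in D) (`|f x + g x| `^ q) <=
  (2 `^ q)%:E * (\int[mu]_(x in D) (`|f x| `^ q) +
                 \int[mu]_(x in D) (`|g x| `^ q)).
Proof.
move=> q0 mD mf mg.
have mp (h : T -> \bar R) := @measurable_powR_abse _ _ _ D h q.
rewrite -ge0_integralD//; [|by move=> *; exact: poweR_ge0|exact: mp
                            |by move=> *; exact: poweR_ge0|exact: mp].
rewrite -ge0_integralZl_EFin ?powR_ge0//; last 2 first.
  by move=> *; rewrite adde_ge0 ?poweR_ge0.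
  by apply: emeasurable_funD; exact: mp.
apply: ge0_le_integral => //.
- by move=> *; exact: poweR_ge0.
- by apply: mp; exact: emeasurable_funD.
- by apply: measurable_funeM; apply: emeasurable_funD; exact: mp.
- by move=> x _; exact: poweR_normD_le.
Qed.

(** The complement of [E] is null for the restricted measure, and that measure is dominated by
    [mu]. *)
Lemma ge0_integral_mrestr_le {d} {T : measurableType d} {R : realType}
    (mu : {measure set T -> \bar R}) (E : set T) (mE : measurable E)
    (f : T -> \bar R) : measurable_fun setT f -> (forall x, 0 <= f x) ->
  \int[mrestr mu mE]_x f x <= \int[mu]_(x in E) f x.
Proof.
move=> mf f0.
rewrite (@ge0_negligible_integral _ _ _ _ setT (~` E) f)//; last 2 first.
  exact: measurableC.
  by rewrite /= /mrestr setICl measure0.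
rewrite setTD setCK; apply: ge0_le_measure_integral => // S mS.
by rewrite /= /mrestr le_measure ?inE//; exact: measurableI.
Qed.

(** Almost every point of [E] lies in some [F i], so [f] is counted at least once in the sum; the
    pieces may overlap and may leave [E]. *)
Lemma ge0_integral_mrestr_cover {d} {T : measurableType d} {R : realType}
    (mu : {measure set T -> \bar R}) (E : set T) (mE : measurable E)
    (I : finType) (F : I -> set T) (f : T -> \bar R) :
  (forall i, measurable (F i)) ->
  mu (E `\` \bigcup_(i in [set: I]) F i) = 0 ->
  measurable_fun setT f -> (forall x, 0 <= f x) ->
  \int[mrestr mu mE]_x f x <= \sum_i \int[mu]_(x in F i) f x.
Proof.
move=> mF EF0 mf f0; apply: (le_trans (ge0_integral_mrestr_le _ _ mE _ mf f0)).
under eq_bigr => i _ do rewrite integral_mkcond.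
have mfF i : measurable_fun setT (f \_ (F i)).
  by apply/(measurable_restrictT _ (mF i)).1; exact: measurable_funTS.
have fF0 i x : 0 <= (f \_ (F i)) x by exact: erestrict_ge0.
rewrite -ge0_integral_sum//.
apply: (@le_trans _ _ (\int[mu]_(x in E) \sum_i (f \_ (F i)) x)); last first.
  apply: ge0_subset_integral => //; first exact: emeasurable_sum.
  by move=> x _; exact: sume_ge0.
apply: ae_ge0_le_integral => //.
- exact: measurable_funTS.
- by move=> x _; exact: sume_ge0.
- by apply: emeasurable_sum => i; exact: measurable_funTS.
exists (E `\` \bigcup_(i in [set: I]) F i); split => //.
  apply: measurableD => //; apply: fin_bigcup_measurable => //.
move=> x /= /not_implyP[Ex fx]; split => // -[i _ Fix]; apply: fx.
rewrite (bigD1 i)//= patchE mem_set// leeDl//.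
by apply: sume_ge0.
Qed.

(** * Lower limits and completeness of [L^q] *)

Lemma limn_einf_le {R : realType} (u : (\bar R)^nat) (k : nat) (l : \bar R) :
  (forall n, (k <= n)%N -> u n <= l) -> limn_einf u <= l.
Proof.
move=> ul; rewrite limn_einf_lim; apply: lime_le; first exact: is_cvg_einfs.
apply: nearW => n; apply: (@le_trans _ _ (u (maxn k n))).
  by apply: ereal_inf_lbound; exists (maxn k n) => //=; exact: leq_maxr.
by rewrite ul// leq_maxl.
Qed.

Lemma limn_einf_ge0 {R : realType} (u : (\bar R)^nat) :
  (forall n, 0 <= u n) -> 0 <= limn_einf u.
Proof.
move=> u0; rewrite limn_einf_lim; apply: lime_ge; first exact: is_cvg_einfs.
by apply: nearW => n; apply: le_ereal_inf_tmp => _ [m _ <-].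
Qed.

Lemma measurable_fun_limn_einf {d} {T : measurableType d} {R : realType}
    (D : set T) (f : nat -> T -> \bar R) :
  (forall n, measurable_fun D (f n)) ->
  measurable_fun D (fun x => limn_einf (f ^~ x)).
Proof.
move=> mf; apply: (@measurableT_comp _ _ _ _ _ _ (@oppe R)) => //.
apply: (@measurable_fun_limn_esup _ _ _ D (fun n x => - f n x)) => n.
exact: measurableT_comp.
Qed.

(** For [l > 0] the power is differentiable, hence continuous, at [l]; for [l = 0] the left-hand
    side is zero. This is the pointwise bound put under the integral before Fatou's lemma. *)
Lemma powR_le_limn_einf {R : realType} (w : nat -> R) (l q : R) :
  (0 < q)%R -> (0 <= l)%R -> w @ \oo --> l ->
  (l `^ q)%:E <= limn_einf (fun n => (w n `^ q)%:E).
Proof.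
move=> q0; rewrite le_eqVlt => /predU1P[<- _|l0 wl].
  by rewrite powR0 ?gt_eqF// limn_einf_ge0// => n; rewrite lee_fin powR_ge0.
have [-> _] // : (limn_einf (fun n => (w n `^ q)%:E) = (l `^ q)%:E) *
                 (limn_esup (fun n => (w n `^ q)%:E) = (l `^ q)%:E).
apply: cvg_limn_einf_sup; apply: cvg_EFin; first exact: nearW.
apply: (@continuous_cvg _ R R _ _ w (@powR R ^~ q) l _ wl).
apply: differentiable_continuous.
by apply/derivable1_diffP; apply: derivable_powR; rewrite in_itv/= l0.
Qed.

Lemma cvgn_geometric_increments {R : realType} (v : nat -> R) (M : R) :
  (forall k, `|v k.+1 - v k| <= M * 2^-1 ^+ k)%R -> cvgn v.
Proof.
move=> vM; have -> : v = (fun n => v 0%N + series (telescope v) n)%R.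
  by apply/funext => n; exact: eq_sum_telescope.
apply: is_cvgD; first exact: is_cvg_cst.
apply: normed_cvg; apply: series_le_cvg (_ : cvgn (series (geometric M 2^-1))) => //=.
- by move=> k; rewrite (le_trans _ (vM k)).
- apply: is_cvg_geometric_series.
  by rewrite ger0_norm// invf_lt1// ltr1n.
Qed.

(** The series of the [f k] has integral at most 2, so its sum is finite almost everywhere, and that
    sum bounds each term. *)
Lemma geometric_integrals_ae {d} {T : measurableType d} {R : realType}
    (mu : {measure set T -> \bar R}) (f : nat -> T -> \bar R) :
  (forall k, measurable_fun setT (f k)) -> (forall k x, 0 <= f k x) ->
  (forall k, \int[mu]_x f k x <= (2^-1 ^+ k)%:E) ->
  {ae mu, forall x, exists M : R, forall k, f k x <= M%:E}.
Proof.
move=> mf f0 f_le.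
pose S x := \sum_(k <oo) f k x.
have S0 x : 0 <= S x by exact: nneseries_ge0.
have mS : measurable_fun setT S.
  by apply: ge0_emeasurable_sum.
have iS : \int[mu]_x S x < +oo.
  rewrite /S integral_nneseries//.
  apply: (@le_lt_trans _ _ (\sum_(k <oo) (2^-1 ^+ k : R)%:E)).
    apply: lee_nneseries => // k _ _; first exact: integral_ge0.
  apply: (@le_lt_trans _ _ 2%:E); last exact: ltry.
  apply: lime_le; first exact: is_cvg_nneseries.
  apply: nearW => n; rewrite sumEFin lee_fin.
  suff -> : (\sum_(0 <= k < n) 2^-1 ^+ k = 2 - 2 * 2^-1 ^+ n :> R)%R.
    by rewrite gerBl mulr_ge0// exprn_ge0.
  elim: n => [|n ih]; first by rewrite big_geq// expr0 mulr1 subrr.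
  by rewrite big_nat_recr//= ih exprS; field.
have : mu.-integrable setT S.
  by apply/integrableP; split => //; under eq_integral do rewrite gee0_abs//.
move=> /(integrable_ae measurableT); apply: filterS => x /(_ I) Sfin.
exists (fine (S x)) => k; rewrite fineK//.
have := @nneseries_lim_ge R (f ^~ x) xpredT 0%N k.+1 (fun n _ _ => f0 n x).
apply: le_trans; rewrite big_nat_recr//= leeDr// sume_ge0//.
Qed.

(* The increments are summable almost everywhere, which gives a pointwise limit;
   Fatou's lemma makes it an L^q limit. *)
Lemma Lq_complete_geometric {d} {T : measurableType d} {R : realType}
    (mu : {measure set T -> \bar R}) (q : R) (v : nat -> T -> R) :
  (1 <= q)%R -> (forall k, measurable_fun setT (v k)) ->
  (forall k l, (k <= l)%N ->
     \int[mu]_x (`|v k x - v l x| `^ q)%:E <= ((4^-1 ^+ k) `^ q)%:E) ->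
  exists2 g : T -> R, measurable_fun setT g &
    forall k, \int[mu]_x (`|v k x - g x| `^ q)%:E <= ((4^-1 ^+ k) `^ q)%:E.
Proof.
move=> q1 mv dv; have q0 : (0 < q)%R by rewrite (lt_le_trans _ q1).
have mD (f h : T -> R) : measurable_fun setT f -> measurable_fun setT h ->
    measurable_fun setT (fun x => (`|f x - h x| `^ q)%:E).
  move=> mf mh; apply/measurable_EFinP.
  apply: (measurableT_comp (measurable_powR q)).
  by apply: measurableT_comp => //; exact: measurable_funB.
(* The weight [2 ^+ k] against the hypothesis [4^-1 ^+ k] leaves integrals at most [2^-1 ^+ k], as
   [q >= 1], while a bound on [f k x] uniform in [k] still makes the increments geometric. *)
pose f k x := ((2 ^+ k) `^ q)%:E * (`|v k x - v k.+1 x| `^ q)%:E.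
have mf k : measurable_fun setT (f k) by apply: measurable_funeM; exact: mD.
have f0 k x : 0 <= f k x by rewrite mule_ge0// lee_fin powR_ge0.
have f_le k : \int[mu]_x f k x <= (2^-1 ^+ k)%:E.
  rewrite ge0_integralZl_EFin ?powR_ge0//; last exact: mD.
  rewrite (@le_trans _ _ (((2 ^+ k) `^ q)%:E * ((4^-1 ^+ k) `^ q)%:E))//.
    by rewrite lee_wpmul2l ?lee_fin ?powR_ge0// dv.
  rewrite -EFinM -powRM ?exprn_ge0// -exprMn lee_fin.
  have -> : (2 * 4^-1 = 2^-1 :> R)%R by field.
  rewrite ge1r_powR// exprn_gt0//= exprn_ile1// invf_le1 ?ler1n//.
have cv : {ae mu, forall x, cvgn (v ^~ x)}.
  have := geometric_integrals_ae mu f mf f0 f_le.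
  apply: filterS => x [M fM].
  apply: (@cvgn_geometric_increments _ _ (M `^ q^-1)%R) => k.
  have := fM k; rewrite /f -EFinM lee_fin -powRM ?exprn_ge0// => kM.
  rewrite exprVn ler_pdivlMr ?exprn_gt0// mulrC distrC.
  have -> : (2 ^+ k * `|v k x - v k.+1 x| =
             ((2 ^+ k * `|v k x - v k.+1 x|) `^ q) `^ q^-1)%R.
    by rewrite -powRrM mulfV ?gt_eqF// powRr1 ?mulr_ge0// exprn_ge0.
  by rewrite ge0_ler_powR ?invr_ge0 ?(ltW q0) ?nnegrE ?powR_ge0//
             (le_trans _ kM)// powR_ge0.
(* The upper limit is defined everywhere and measurable, and equals the limit wherever the sequence
   converges. *)
pose g x := fine (limn_esup (fun k => (v k x)%:E)).
have mg : measurable_fun setT g.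
  apply: measurableT_comp => //; apply: measurable_fun_limn_esup => k.
  exact/measurable_EFinP.
have vg : {ae mu, forall x, v ^~ x @ \oo --> g x}.
  apply: filterS cv => x cvx; rewrite /g.
  have vx : (v k x)%:E @[k --> \oo] --> (limn (v ^~ x))%:E.
    by apply: cvg_EFin => //; exact: nearW.
  by have [_ ->] := cvg_limn_einf_sup vx.
exists g => // k.
pose h l x := (`|v k x - v l x| `^ q)%:E.
have mh l : measurable_fun setT (h l) by exact: mD.
have h0 l x : 0 <= h l x by rewrite lee_fin powR_ge0.
apply: (@le_trans _ _ (\int[mu]_x limn_einf (h ^~ x))).
  apply: ae_ge0_le_integral => //.
  - exact: mD.
  - by move=> x _; exact: limn_einf_ge0.
  - exact: measurable_fun_limn_einf.
  apply: filterS vg => x vx _; apply: powR_le_limn_einf => //.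
  by apply: cvg_norm; apply: cvgB => //; exact: cvg_cst.
apply: (le_trans (fatou mu measurableT _ _)) => //.
(* Fatou's lemma is applied in [l] with [k] fixed; the bound holds for [l >= k], which is enough for
   a lower limit. *)
by apply: (@limn_einf_le _ _ k) => l kl; exact: dv.
Qed.

(** * Limits along ultrafilters and extraction of subsequences *)

(** The image filter lives on a compact segment and so has a cluster point. It is a limit: if the
    preimage of a neighbourhood [V] were not in [U], its complement would be, against clustering. *)
Lemma ultra_bounded_cvg {R : realType} (U : set_system nat) (a : nat -> R) :
  UltraFilter U -> bounded_fun a -> exists l : R, a @ U --> l.
Proof.
move=> UU ba.
have [M aM] : exists M : R, forall n, (`|a n| <= M)%R.
  have [M [_ aM]] := ba; exists (M + 1)%R => n; apply: aM => //.
  by rewrite ltrDl.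
have UP := @ultra_proper _ _ UU.
have [|l [_ al]] := @segment_compact R (- M) M (a @ U) _.
  by apply: (@filterE _ U) => n /=; rewrite in_itv/= -ler_norml.
exists l => V Vl; have [//|UnV] := in_ultra_setVsetC (a @^-1` V) UU.
by have [x [xn /xn]] := al (~` V) V UnV Vl.
Qed.

(** Each intersection of [P 0], ..., [P k] with a tail of the integers belongs to [U], hence is
    nonempty; terms are chosen recursively in these sets. *)
Lemma subseq_in_filter (U : set_system nat) (P : nat -> set nat) :
  ProperFilter U -> \oo `<=` U -> (forall k, U (P k)) ->
  exists2 phi : nat -> nat, {homo phi : i j / (i < j)%N} &
    forall k j, (k <= j)%N -> P k (phi j).
Proof.
move=> UP Uoo UPk.
have UQ k : U (fun m => forall j, (j <= k)%N -> P j m).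
  elim: k => [|k ih].
    by apply: filterS (UPk 0%N) => m Pm j; rewrite leqn0 => /eqP ->.
  apply: filterS2 ih (UPk k.+1) => m Pm Pk j.
  by rewrite leq_eqVlt ltnS => /predU1P[->//|/Pm].
have next (kn : nat * nat) :
    exists m, (kn.2 < m)%N /\ forall j, (j <= kn.1)%N -> P j m.
  apply: (@filter_ex _ U); apply: filterS2 (UQ kn.1) (Uoo _ (nbhs_infty_gt kn.2)).
  by move=> m Pm.
have [g gP] := choice next.
(* In the argument of [g], the first entry is the last set to be met and the second is the term to
   be exceeded. *)
pose phi := nat_rect (fun=> nat) (g (0, 0)%N) (fun k n => g (k.+1, n)).
exists phi.
  by apply: homo_ltn => [j i k|k]; [exact: ltn_trans|have [] := gP (k.+1, phi k)].
move=> k [|j] kj; first by have [_] := gP (0, 0)%N; apply.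
by have [_] := gP (j.+1, phi j); apply.
Qed.

(** * Summing the Poincare inequalities *)

Lemma max_overlap_lty {d} {T : measurableType d} {R : realType}
    (mu : {measure set T -> \bar R}) (k : nat) (F : 'I_k -> set T) :
  max_overlap mu F < +oo.
Proof.
apply: (@le_lt_trans _ _ (k%:R)%:E); last exact: ltry.
apply/ess_supP; apply: nearW => x; rewrite lee_fin.
apply: (@le_trans _ _ (\sum_(i < k) 1)%R); last by rewrite sumr_const card_ord.
by apply: ler_sum => i _; rewrite indicE lern1 leq_b1.
Qed.

(** After exchanging sum and integral, the integrand is [g] times the overlap count, which is almost
    everywhere at most its essential supremum. The maximum with 0 covers the value [-oo] taken for a
    zero measure. *)
Lemma sum_integral_overlap_le {d} {T : measurableType d} {R : realType}
    (mu : {measure set T -> \bar R}) (k : nat) (F : 'I_k -> set T)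
    (g : T -> \bar R) :
  (forall i, measurable (F i)) -> measurable_fun setT g ->
  (forall x, 0 <= g x) ->
  \sum_i \int[mu]_(x in F i) g x <= maxe 0 (max_overlap mu F) * \int[mu]_x g x.
Proof.
move=> mF mg g0.
have N0 : 0 <= maxe 0 (max_overlap mu F) by rewrite le_max lexx.
rewrite -ge0_integralZl//.
have mgF i : measurable_fun setT (g \_ (F i)).
  by apply/(measurable_restrictT _ (mF i)).1; exact: measurable_funTS.
have gF0 i x : 0 <= (g \_ (F i)) x by exact: erestrict_ge0.
under eq_bigr => i _ do rewrite integral_mkcond.
rewrite -ge0_integral_sum//; apply: ae_ge0_le_integral => //.
- by move=> x _; exact: sume_ge0.
- exact: emeasurable_sum.
- by move=> x _; exact: mule_ge0.
- exact: measurable_funeM.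
have := ess_sup_ge mu (fun x => (\sum_(i < k) \1_(F i) x)%:E).
apply: filterS => x Nx _.
rewrite (_ : \sum_i (g \_ (F i)) x = (\sum_(i < k) \1_(F i) x)%:E * g x).
  by rewrite lee_wpmul2r// le_max Nx orbT.
rewrite -sumEFin ge0_sume_distrl//; apply: eq_bigr => i _.
by rewrite patchE indicE; case: ifP => _; rewrite ?mul1e ?mul0e.
Qed.

Lemma sum_oscillation_le {d} {T : measurableType d} {R : realType}
    (mu : {measure set T -> \bar R}) (k : nat) (F : 'I_k -> set T)
    (p q C : R) (g : T -> R) (osc : 'I_k -> \bar R) :
  (1 <= p)%R -> (0 < q)%R -> (forall i, measurable (F i)) ->
  g \in Lfun mu p%:E -> {ae mu, forall x, (0 <= g x)%R} ->
  (forall i, 0 <= osc i) ->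
  (forall i, osc i `^ q^-1 <=
    C%:E * (\int[mu]_(x in F i) (g x `^ p)%:E) `^ p^-1) ->
  \sum_i osc i <= ((Num.max 0 C)%:E * max_overlap mu F `^ p^-1 *
                   (hoelder_const p q k)%:E * 'N[mu]_p%:E[EFin \o g]) `^ q.
Proof.
move=> p1 q0 mF gLp g0 osc0 oscC.
have p0 : (0 < p)%R by rewrite (lt_le_trans _ p1).
have mg : measurable_fun setT g by have /sub_Lfun_mfun := gLp; rewrite inE.
have gfin : 'N[mu]_p%:E[EFin \o g] < +oo.
  by have /sub_Lfun_finLfun := gLp; rewrite inE.
pose h x := (g x `^ p)%:E.
have mh : measurable_fun setT h.
  by apply/measurable_EFinP; exact: (measurableT_comp (measurable_powR p)).
have h0 x : 0 <= h x by rewrite lee_fin powR_ge0.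
(* The norm contains [|g|] and the hypothesis [g]; the two integrands can differ only on the null
   set where [g] is negative. *)
have hE : \int[mu]_x h x = 'N[mu]_p%:E[EFin \o g] `^ p.
  rewrite poweR_Lnorm ?gt_eqF//; apply: ge0_ae_eq_integral => //.
  - exact/measurable_powR_abse/measurable_EFinP.
  - by move=> x _; exact: poweR_ge0.
  - by apply: filterS g0 => x gx _ /=; rewrite /h ger0_norm.
(* The sign of [C] is not prescribed; truncation at 0 keeps the bases of all powers nonnegative. *)
pose c := Num.max 0%R C; have c0 : (0 <= c)%R by rewrite le_max lexx.
pose A := fine 'N[mu]_p%:E[EFin \o g].
have A0 : (0 <= A)%R by rewrite fine_ge0// Lnorm_ge0.
have NA : 'N[mu]_p%:E[EFin \o g] = A%:E.
  by rewrite fineK// ge0_fin_numE// Lnorm_ge0.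
pose N := fine (maxe 0 (max_overlap mu F)).
have N0 : (0 <= N)%R by rewrite fine_ge0// le_max lexx.
have NE : maxe 0 (max_overlap mu F) = N%:E.
  by rewrite fineK// ge0_fin_numE ?le_max ?lexx// gt_max ltry max_overlap_lty.
pose M := fine (max_overlap mu F `^ p^-1).
have ME : max_overlap mu F `^ p^-1 = M%:E.
  by rewrite fineK// ge0_fin_numE ?poweR_ge0// poweR_lty// max_overlap_lty.
have M0 : (0 <= M)%R by rewrite -lee_fin -ME poweR_ge0.
(* A negative essential supremum is truncated to [N = 0], whose root is 0. *)
have NM : (N `^ p^-1 <= M)%R.
  rewrite -lee_fin -ME -poweR_EFin -NE; have [//|_] := leP 0 (max_overlap mu F).
  by rewrite poweR0r ?poweR_ge0// invr_neq0// gt_eqF.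
pose b i := fine (\int[mu]_(x in F i) h x).
have b0 i : (0 <= b i)%R by rewrite fine_ge0// integral_ge0.
have bE i : \int[mu]_(x in F i) h x = (b i)%:E.
  rewrite fineK// ge0_fin_numE ?integral_ge0//.
  apply: (@le_lt_trans _ _ (\int[mu]_x h x)); first exact: ge0_subset_integral.
  by rewrite hE poweR_lty.
have bS : (\sum_i b i <= N * A `^ p)%R.
  have := sum_integral_overlap_le mu k F h mF mh h0.
  rewrite NE hE NA; under eq_bigr => i _ do rewrite bE.
  by rewrite sumEFin -EFinM lee_fin.
have osc_le i : osc i <= ((c * b i `^ p^-1) `^ q)%:E.
  rewrite -[leLHS](@poweRe1 R)// -[1%R](@mulVf _ q) ?gt_eqF// poweRrM.
  rewrite -poweR_EFin; apply: gt0_ler_poweR; first exact: ltW.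
  - by rewrite in_itv/= poweR_ge0 leey.
  - by rewrite in_itv/= leey andbT lee_fin mulr_ge0 ?powR_ge0.
  rewrite (le_trans (oscC i))// bE EFinM lee_wpmul2r ?poweR_ge0//.
  by rewrite lee_fin le_max lexx orbT.
have kc0 : (0 <= hoelder_const p q k)%R.
  by rewrite /hoelder_const; case: ifP => // _; exact: powR_ge0.
rewrite ME NA -!EFinM poweR_EFin (le_trans (lee_sum _ (fun i _ => osc_le i)))//.
rewrite sumEFin lee_fin (le_trans (sum_powR_hoelder _ _ _ _ _ p0 q0 c0 b0))//.
have S0 : (0 <= \sum_i b i)%R by exact: sumr_ge0.
rewrite ge0_ler_powR ?(ltW q0) ?nnegrE ?mulr_ge0 ?powR_ge0// -/c.
rewrite [(c * M * _)%R]mulrAC -[leRHS]mulrA ler_wpM2l ?mulr_ge0//.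
apply: (@le_trans _ _ ((N * A `^ p) `^ p^-1)%R).
  by rewrite ge0_ler_powR ?invr_ge0 ?(ltW p0) ?nnegrE// mulr_ge0// powR_ge0.
rewrite powRM ?powR_ge0// -powRrM mulfV ?gt_eqF// powRr1//.
by rewrite ler_wpM2r.
Qed.

(** * Compactness from approximation by constants on pieces *)

(** Split [f i] as [(f i - a i) + a i]. This serves both to move the coefficients to their limits
    and to show that each function is in [L^q] on [E]. *)
Lemma sum_integral_powR_le {d} {T : measurableType d} {R : realType}
    (mu : {measure set T -> \bar R}) (q : R) (k : nat) (F : 'I_k -> set T)
    (f : 'I_k -> T -> \bar R) (a : 'I_k -> R) (s t : \bar R) :
  (0 < q)%R -> (forall i, measurable (F i)) ->
  (forall i, measurable_fun setT (f i)) ->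
  \sum_i \int[mu]_(x in F i) (`|f i x - (a i)%:E| `^ q) <= s ->
  \sum_i (`|a i| `^ q)%:E * mu (F i) <= t ->
  \sum_i \int[mu]_(x in F i) (`|f i x| `^ q) <= (2 `^ q)%:E * (s + t).
Proof.
move=> q0 mF mf fs at_; apply: (@le_trans _ _ (\sum_i (2 `^ q)%:E *
    (\int[mu]_(x in F i) (`|f i x - (a i)%:E| `^ q) +
     \int[mu]_(x in F i) (`|(a i)%:E| `^ q)))).
  apply: lee_sum => i _.
  under eq_integral => x _ do rewrite -[f i x](@subeK _ _ (a i)%:E)//.
  apply: integral_powR_normD_le => //.
  by apply: emeasurable_funB => //; exact: measurable_funTS.
rewrite -ge0_sume_distrr; last first.
  by move=> i _; rewrite adde_ge0 ?integral_ge0// => x _; exact: poweR_ge0.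
rewrite lee_wpmul2l ?lee_fin ?powR_ge0// big_split/= leeD//.
by under eq_bigr do rewrite integral_cst//.
Qed.

(* Along an ultrafilter every bounded sequence of coefficients converges, so no
   diagonal extraction of subsequences is needed. *)
Lemma ultra_Lq_small_diameter {d} {T : measurableType d} {R : realType}
    (mu : {measure set T -> \bar R}) (E : set T) (mE : measurable E)
    (U : set_system nat) (q eps : R) (v : nat -> T -> R)
    (k : nat) (F : 'I_k -> set T) (a : 'I_k -> nat -> R) :
  UltraFilter U -> (0 < q)%R -> (0 < eps)%R ->
  (forall n, measurable_fun setT (v n)) ->
  (forall i, measurable (F i)) -> (forall i, mu (F i) < +oo) ->
  mu (E `\` \bigcup_(i in [set: 'I_k]) F i) = 0 ->
  (forall i, bounded_fun (a i)) ->
  (forall n, \sum_i \int[mu]_(x in F i) (`|v n x - a i n| `^ q)%:E <= eps%:E) ->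
  exists2 A, U A & forall n m, A n -> A m ->
    \int[mrestr mu mE]_x (`|v n x - v m x| `^ q)%:E <=
    (4 * (2 `^ q * 2 `^ q) * eps)%:E.
Proof.
move=> UU q0 eps0 mv mF Ffin EF ba osc.
have UP := @ultra_proper _ _ UU.
have [al alP] := choice (fun i => ultra_bounded_cvg U (a i) UU (ba i)).
pose V := (\sum_i fine (mu (F i)))%R.
have muF i : mu (F i) = (fine (mu (F i)))%:E by rewrite fineK// ge0_fin_numE.
have V0 : (0 <= V)%R by apply: sumr_ge0 => i _; exact: fine_ge0.
pose eta := ((eps / (V + 1)) `^ q^-1)%R.
have V1 : (0 < V + 1)%R by rewrite ltr_wpDl.
have eta0 : (0 < eta)%R by apply: powR_gt0; exact: divr_gt0.
exists [set n | forall i, (`|a i n - al i| <= eta)%R].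
  apply: filter_forall => i; have /cvgrPdist_le/(_ _ eta0) := alP i.
  by apply: filterS => n; rewrite distrC.
(* The values [al i] do not depend on [n], so they serve as a common centre. The splitting constant
   is [a i n - al i], which leaves [v n x - a i n]. *)
have near_al n : (forall i, (`|a i n - al i| <= eta)%R) ->
    \sum_i \int[mu]_(x in F i) (`|(v n x - al i)%:E| `^ q) <=
    (2 `^ q * (eps + eps))%:E.
  move=> an; rewrite EFinM EFinD; apply: (@sum_integral_powR_le _ _ _ mu q k F
    (fun i x => (v n x - al i)%:E) (fun i => a i n - al i)%R) => //.
  - by move=> i; apply/measurable_EFinP; exact: measurable_funB.
  - rewrite (le_trans _ (osc n))// lee_sum// => i _.
    rewrite le_eqVlt; apply/orP; left; apply/eqP; apply: eq_integral => x _ /=.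
    by rewrite opprB addrA subrK.
  rewrite (@le_trans _ _ (\sum_i (eta `^ q * fine (mu (F i)))%:E))//.
    apply: lee_sum => i _; rewrite muF -EFinM lee_fin ler_wpM2r ?fine_ge0//.
    by rewrite ge0_ler_powR ?(ltW q0) ?nnegrE// ltW.
  rewrite sumEFin lee_fin -mulr_sumr -/V /eta -powRrM mulVf ?gt_eqF// powRr1.
    by rewrite mulrAC ler_pdivrMr// ler_wpM2l ?(ltW eps0)// lerDl.
  by rewrite divr_ge0 ?(ltW eps0) ?(ltW V1).
move=> n m An Am.
have mvv : measurable_fun setT (fun x => (`|v n x - v m x| `^ q)%:E).
  apply/measurable_EFinP; apply: (measurableT_comp (measurable_powR q)).
  by apply: measurableT_comp => //; exact: measurable_funB.
apply: (le_trans (ge0_integral_mrestr_cover _ _ mE _ F _ mF EF mvv _)).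
  by move=> x; rewrite lee_fin powR_ge0.
(* Passing through [al i] costs another [2]^ q[and adds two bounds]2 [^ q * (eps + eps)], whence the
   factor 4. *)
apply: (@le_trans _ _ (\sum_i (2 `^ q)%:E *
    (\int[mu]_(x in F i) (`|(v n x - al i)%:E| `^ q) +
     \int[mu]_(x in F i) (`|(v m x - al i)%:E| `^ q)))).
  apply: lee_sum => i _.
  have -> : \int[mu]_(x in F i) (`|v m x - al i|%R%:E `^ q) =
            \int[mu]_(x in F i) (`|(al i - v m x)%:E| `^ q).
    by apply: eq_integral => x _; rewrite /= distrC.
  have -> : \int[mu]_(x in F i) (`|v n x - v m x| `^ q)%:E =
     \int[mu]_(x in F i) (`|(v n x - al i)%:E + (al i - v m x)%:E| `^ q).
    by apply: eq_integral => x _; rewrite /= addrA subrK.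
  apply: integral_powR_normD_le => //.
  - by apply/measurable_EFinP; apply: measurable_funTS; exact: measurable_funB.
  - by apply/measurable_EFinP; apply: measurable_funTS; exact: measurable_funB.
rewrite -ge0_sume_distrr; last first.
  by move=> i _; rewrite adde_ge0 ?integral_ge0// => x _; exact: poweR_ge0.
rewrite big_split/=.
rewrite (@le_trans _ _ ((2 `^ q)%:E * ((2 `^ q * (eps + eps))%:E +
                                      (2 `^ q * (eps + eps))%:E)))//.
  by rewrite lee_wpmul2l ?lee_fin ?powR_ge0// leeD// near_al.
by rewrite -EFinD -EFinM lee_fin; lra.
Qed.

(** At an infinite [x] the right-hand side is [+oo]. Hence replacing a function by its real part
    does not increase its oscillation. *)
Lemma powR_fine_le {R : realType} (x : \bar R) (c q : R) : (0 < q)%R ->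
  (`|fine x - c| `^ q)%:E <= `|x - c%:E| `^ q.
Proof. by move=> q0; case: x => [r| |]//=; rewrite gt_eqF// leey. Qed.

Lemma Lnorm_ltyP {d} {T : measurableType d} {R : realType}
    (mu : {measure set T -> \bar R}) (q : R) (f : T -> \bar R) : (0 < q)%R ->
  'N[mu]_q%:E[f] < +oo <-> \int[mu]_x (`|f x| `^ q) < +oo.
Proof.
move=> q0; rewrite -poweR_Lnorm ?gt_eqF//; split; first exact: poweR_lty.
by apply: lty_poweRy; rewrite gt_eqF.
Qed.

Lemma ae_fine_Lnorm {d} {T : measurableType d} {R : realType}
    (mu : {measure set T -> \bar R}) (q : R) (f : T -> \bar R) : (0 < q)%R ->
  measurable_fun setT f -> \int[mu]_x (`|f x| `^ q) < +oo ->
  {ae mu, forall x, f x = (fine (f x))%:E}.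
Proof.
move=> q0 mf fq.
have : mu.-integrable setT (fun x => `|f x| `^ q).
  apply/integrableP; split; first exact: measurable_powR_abse.
  by under eq_integral do rewrite gee0_abs ?poweR_ge0//.
move=> /(integrable_ae measurableT); apply: filterS => x /(_ I).
by case: (f x) => //=; rewrite gt_eqF.
Qed.

(** For every [k] the ultrafilter contains a set of indices of diameter at most [4^-1 ^+ k]; a
    subsequence eventually in all these sets meets the geometric completeness criterion. *)
Lemma Lq_subseq_of_step_approximation {d} {T : measurableType d} {R : realType}
    (mu : {measure set T -> \bar R}) (E : set T) (mE : measurable E) (q : R)
    (u : nat -> T -> \bar R) : (1 <= q)%R -> (forall n, measurable_fun setT (u n)) ->
  (forall eps : R, (0 < eps)%R ->
    exists k (F : 'I_k -> set T) (a : 'I_k -> nat -> R),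
    [/\ forall i, measurable (F i), forall i, mu (F i) < +oo,
        mu (E `\` \bigcup_(i in [set: 'I_k]) F i) = 0,
        forall i, bounded_fun (a i) &
        forall n, \sum_i \int[mu]_(x in F i) (`|u n x - (a i n)%:E| `^ q) <=
                  eps%:E]) ->
  exists phi : nat -> nat, {homo phi : i j / (i < j)%N} /\
    converges_in_Lp (mrestr mu mE) q (u \o phi).
Proof.
move=> q1 mu_ approx; have q0 : (0 < q)%R by rewrite (lt_le_trans _ q1).
pose lam := mrestr mu mE; pose v n x := fine (u n x).
have mv n : measurable_fun setT (v n) by apply: measurableT_comp.
have mD (f g : T -> R) : measurable_fun setT f -> measurable_fun setT g ->
    measurable_fun setT (fun x => (`|f x - g x| `^ q)%:E).
  move=> mf mg; apply/measurable_EFinP.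
  apply: (measurableT_comp (measurable_powR q)).
  by apply: measurableT_comp => //; exact: measurable_funB.
have ufin n : \int[lam]_x (`|u n x| `^ q) < +oo.
  (* The approximation with error 1 suffices here: constants have finite [q]-integral over pieces of
     finite measure. *)
  have [k [F [a [mF Ffin EF _ /(_ n) osc]]]] := approx 1%R ltr01.
  apply: le_lt_trans.
    apply: (ge0_integral_mrestr_cover _ _ mE _ F _ mF EF).
      exact: measurable_powR_abse.
    by move=> x; exact: poweR_ge0.
  apply: le_lt_trans.
    apply: (@sum_integral_powR_le _ _ _ mu q k F (fun=> u n) (a ^~ n)) => //.
  rewrite lte_mul_pinfty ?lee_fin ?powR_ge0// lte_add_pinfty ?(le_lt_trans osc) ?ltry//.
  apply/lte_sum_pinfty => i _.
  by rewrite lte_mul_pinfty ?lee_fin ?powR_ge0.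
have uv n : {ae lam, forall x, u n x = (v n x)%:E}.
  by apply: (ae_fine_Lnorm lam q).
(* An ultrafilter containing all tails has no finite member, so indices in its sets can be taken
   increasing. *)
have [U [UU Uoo]] := ultraFilterLemma eventually_filter.
have UP := @ultra_proper _ _ UU.
have diam k : exists A, U A /\ forall n m, A n -> A m ->
    \int[lam]_x (`|v n x - v m x| `^ q)%:E <= ((4^-1 ^+ k) `^ q)%:E.
  (* This is the constant of [ultra_Lq_small_diameter]; dividing by it in advance gives exactly the
     wanted diameter. *)
  pose c : R := (4 * (2 `^ q * 2 `^ q))%R.
  have c0 : (0 < c)%R by rewrite !mulr_gt0// powR_gt0.
  have eps0 : (0 < (4^-1 ^+ k) `^ q / c)%R.
    by rewrite divr_gt0// powR_gt0// exprn_gt0.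
  have [l [F [a [mF Ffin EF ba osc]]]] := approx _ eps0.
  have vosc n : \sum_i \int[mu]_(x in F i) (`|v n x - a i n| `^ q)%:E <=
      ((4^-1 ^+ k) `^ q / c)%:E.
    apply: le_trans (osc n); apply: lee_sum => i _.
    apply: ge0_le_integral => //.
    - by apply: measurable_funTS; exact: (mD _ (cst _) (mv n) (measurable_cst _)).
    - apply: measurable_powR_abse; apply: measurable_funTS.
      exact: emeasurable_funB.
    - by move=> x _; exact: powR_fine_le.
  have [A UA AP] :=
    ultra_Lq_small_diameter mu E mE U q _ v l F a UU q0 eps0 mv mF Ffin EF ba vosc.
  exists A; split => // n m An Am; apply: le_trans (AP n m An Am) _.
  by rewrite lee_fin -/c mulrC divfK ?gt_eqF.
have [A AP] := choice diam.
have [phi phi_incr phiP] := subseq_in_filter U A UP Uoo (fun k => (AP k).1).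
have [g mg gP] : exists2 g : T -> R, measurable_fun setT g & forall k,
    \int[lam]_x (`|v (phi k) x - g x| `^ q)%:E <= ((4^-1 ^+ k) `^ q)%:E.
  apply: Lq_complete_geometric => // k l kl.
  by apply: (AP k).2; apply: phiP.
exists phi; split => //; split.
  by move=> n; split; [exact: mu_|apply/(Lnorm_ltyP lam _ _ q0); exact: ufin].
have gE k : \int[lam]_x (`|u (phi k) x - (g x)%:E| `^ q) <= ((4^-1 ^+ k) `^ q)%:E.
  apply: le_trans (gP k); rewrite le_eqVlt; apply/orP; left; apply/eqP.
  apply: ge0_ae_eq_integral => //.
  - by apply: measurable_powR_abse; apply: emeasurable_funB => //; exact/measurable_EFinP.
  - exact: mD.
  - by move=> x _; exact: poweR_ge0.
  - by apply: filterS (uv (phi k)) => x -> _.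
have mg' : measurable_fun setT (EFin \o g) by exact/measurable_EFinP.
exists g.
  rewrite inE; apply/andP; split; first by rewrite inE.
  rewrite inE/=; apply/(Lnorm_ltyP lam _ _ q0).
  (* The limit inherits integrability from the first term of the subsequence, at finite distance
     from it. *)
  have -> : \int[lam]_x (`|(EFin \o g) x| `^ q) =
      \int[lam]_x (`|(v (phi 0%N) x)%:E + (g x - v (phi 0%N) x)%:E| `^ q).
    by apply: eq_integral => x _; rewrite /= subrKC.
  apply: le_lt_trans.
    apply: integral_powR_normD_le => //; first exact/measurable_EFinP.
    by apply/measurable_EFinP; exact: measurable_funB.
  rewrite lte_mul_pinfty ?lee_fin ?powR_ge0// lte_add_pinfty//.
    apply: le_lt_trans (ufin (phi 0%N)); apply: ge0_le_integral => //.
    - by move=> x _; exact: poweR_ge0.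
    - by apply: measurable_powR_abse; exact/measurable_EFinP.
    - exact: measurable_powR_abse.
    - move=> x _; have := @powR_fine_le _ (u (phi 0%N) x) 0 _ q0.
      by rewrite subr0 sube0.
  apply: (le_lt_trans _ (ltry _)); apply: le_trans (gP 0%N).
  by rewrite le_eqVlt; apply/orP; left; apply/eqP; apply: eq_integral => x _;
     rewrite /= distrC.
have half0 : (4^-1 ^+ k : R)%:E @[k --> \oo] --> 0%E.
  apply: cvg_EFin; first exact: nearW.
  by apply: cvg_expr; rewrite ger0_norm// invf_lt1// ltr1n.
apply: (squeeze_cvge _ (cvg_cst 0) half0); apply: nearW => k.
rewrite Lnorm_ge0/= unlock/= (@le_trans _ _ (((4^-1 ^+ k) `^ q)%:E `^ q^-1))//.
  apply: gt0_ler_poweR (gE k); first by rewrite invr_ge0 ltW.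
  - by rewrite in_itv/= leey andbT integral_ge0// => x _; exact: poweR_ge0.
  - by rewrite in_itv/= leey andbT lee_fin powR_ge0.
by rewrite poweR_EFin -powRrM mulfV ?gt_eqF// powRr1// exprn_ge0.
Qed.

(** * From Poincare inequalities to a convergent subsequence *)

Theorem theorem2p3 (R : realType) (X : pointedMetricType R)
  (Smu Snu : set (set X))
  (mu : {measure set (g_sigma_algebraType Smu) -> \bar R})
  (nu : {measure set (g_sigma_algebraType Snu) -> \bar R})
  (mu_borel : complete_borel mu) (nu_borel : complete_borel nu)
  (E : set (g_sigma_algebraType Snu)) (mE : measurable E) (nuE : 0 < nu E)
  (p q : R) (p_ge1 : (1 <= p)%R) (q_ge1 : (1 <= q)%R)
  (Y : set (g_sigma_algebraType Snu -> \bar R))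
  (mY : forall u, Y u -> measurable_fun setT u)
  (K : nat -> nat)
  (F : forall m, 'I_(K m) -> set (g_sigma_algebraType Snu))
  (F' : forall m, 'I_(K m) -> set (g_sigma_algebraType Smu))
  (mF : forall m i, measurable (F m i))
  (F_cover : forall m, nu (E `\` \bigcup_(i in [set: 'I_(K m)]) F m i) = 0)
  (F_pos : forall m i, 0 < nu (F m i) < +oo)
  (mF' : forall m i, measurable (F' m i))
  (a : forall m, 'I_(K m) -> (g_sigma_algebraType Snu -> \bar R) -> R)
  (G : nat -> (g_sigma_algebraType Snu -> \bar R) ->
       g_sigma_algebraType Smu -> R)
  (G_Lp : forall m u, Y u -> G m u \in Lfun mu p%:E)
  (G_ge0 : forall m u, Y u -> {ae mu, forall x, (0 <= G m u x)%R})
  (C : nat -> R)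
  (poincare : forall m u (i : 'I_(K m)), Y u ->
    (\int[nu]_(x in F m i) (`|u x - (a m i u)%:E| `^ q)) `^ q^-1 <=
    (C m)%:E * (\int[mu]_(x in F' m i) (G m u x `^ p)%:E) `^ p^-1)
  (u : nat -> g_sigma_algebraType Snu -> \bar R)
  (uY : forall n, Y (u n))
  (a_bounded : forall m (i : 'I_(K m)), bounded_fun (fun n => a m i (u n)))
  (cond :
    (((p <= q)%R /\
      (C m)%:E * max_overlap mu (F' m) `^ p^-1 *
        ereal_sup [set 'N[mu]_p%:E[EFin \o G m (u n)] | n in [set: nat]]
        @[m --> \oo] --> 0) \/
     ((q < p)%R /\
      (C m)%:E * max_overlap mu (F' m) `^ p^-1 *
        ((K m)%:R `^ (q^-1 - p^-1))%:E *
        ereal_sup [set 'N[mu]_p%:E[EFin \o G m (u n)] | n in [set: nat]]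
        @[m --> \oo] --> 0))) :
  exists phi : nat -> nat,
    {homo phi : i j / (i < j)%N} /\
    converges_in_Lp (mrestr nu mE) q (u \o phi).
Proof.
have p0 : (0 < p)%R by rewrite (lt_le_trans _ p_ge1).
have q0 : (0 < q)%R by rewrite (lt_le_trans _ q_ge1).
pose S m := ereal_sup [set 'N[mu]_p%:E[EFin \o G m (u n)] | n in [set: nat]].
(* The factor [hoelder_const] merges the two alternatives into one limit. *)
have {}cond : (C m)%:E * max_overlap mu (F' m) `^ p^-1 *
    (hoelder_const p q (K m))%:E * S m @[m --> \oo] --> 0.
  rewrite /hoelder_const; case: cond => -[pq cond].
    by rewrite pq; under eq_cvg do rewrite mule1.
  by rewrite leNgt pq.
apply: Lq_subseq_of_step_approximation => // [n|eps eps0]; first exact: mY.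
(* One [m] serves all [n], because of the supremum in [S m]. The threshold is a [q]-th root since
   the error is a sum of [q]-th powers. *)
have /cond[m _ /(_ m (leqnn m)) /= Sm] :
    nbhs (0 : \bar R) [set x | x < (eps `^ q^-1)%:E].
  by apply: open_nbhs_nbhs; split => /=; [exact: open_ereal_lt_ereal|
    rewrite lte_fin powR_gt0].
exists (K m), (F m), (fun i n => a m i (u n)); split => //.
- by move=> i; have /andP[] := F_pos m i.
- by move=> i; exact: a_bounded.
move=> n.
have osc0 i : 0 <= \int[nu]_(x in F m i) (`|u n x - (a m i (u n))%:E| `^ q).
  by apply: integral_ge0 => x _; exact: poweR_ge0.
have osc_le := sum_oscillation_le mu _ (F' m) p q (C m) (G m (u n)) _ p_ge1 q0
  (mF' m) (G_Lp m _ (uY n)) (G_ge0 m _ (uY n)) osc0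
  (fun i => poincare m _ i (uY n)).
apply: (le_trans osc_le).
have kc0 : 0 <= (hoelder_const p q (K m))%:E :> \bar R.
  by rewrite lee_fin /hoelder_const; case: ifP => // _; exact: powR_ge0.
have -> : eps%:E = (eps `^ q^-1)%:E `^ q.
  by rewrite poweR_EFin -powRrM mulVf ?gt_eqF// powRr1// ltW.
apply: gt0_ler_poweR; first exact: ltW.
- by rewrite in_itv/= leey andbT !mule_ge0 ?Lnorm_ge0 ?poweR_ge0// lee_fin le_max lexx.
- by rewrite in_itv/= leey andbT lee_fin powR_ge0.
(* For [C m <= 0] the truncated constant is 0 and the product vanishes; otherwise it is [C m], and
   the norm is bounded by the supremum. *)
have [C0|C0] := leP (C m) 0%R.
  by rewrite !mul0e lee_fin powR_ge0.
apply: le_trans (ltW Sm); apply: lee_wpmul2l.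
  by rewrite !mule_ge0 ?poweR_ge0// lee_fin ltW.
by apply: ereal_sup_ubound; exists n.
Qed.
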